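(* Let $p$ be prime and $2\le k\le p$, and put $m=\lceil p/k\rceil$. If $2m-3<p$ and $m\ge 5$, then in every optimal $k$-coloring of $\mathbb{Z}_p$ attaining $\widehat{\Phi}_k(p)=2m-3$, there exists a color class $A$ of size $m$ that is an arc (equivalently, an arithmetic progression up to an affine automorphism $x\mapsto ux+v$ with $u\in\mathbb{Z}_p^\times$).
   Context: For an integer $n\ge 2$, $\mathbb{Z}_n=\{0,1,\dots,n-1\}$ denotes the additive cyclic group with addition modulo $n$. For $A\subseteq\mathbb{Z}_n$ the restricted self-sumset is $A\widehat{+}A=\{a+a' \pmod n : a,a'\in A,\ a\ne a'\}$, with $|A\widehat{+}A|=0$ if $|A|\le 1$. A $k$-coloring of $\mathbb{Z}_n$ is a disjoint union $\mathbb{Z}_n=A_1\sqcup\cdots\sqcup A_k$, and the sets $A_i$ are its color classes. Define $$\widehat{\Phi}_k(n)=\min_{\mathbb{Z}_n=A_1\sqcup\cdots\sqcup A_k}\ \max_{1\le i\le k}|A_i\widehat{+}A_i|,$$ the minimum being over all $k$-colorings of $\mathbb{Z}_n$. A $k$-coloring of $\mathbb{Z}_n$ is optimal if its value $\max_{1\le i\le k}|A_i\widehat{+}A_i|$ equals $\widehat{\Phi}_k(n)$. Viewing $\mathbb{Z}_n$ as the circle $\{0,1,\dots,n-1\}$ in cyclic order, an arc is a set of consecutive residues (possibly wrapping around from $n-1$ to $0$). $\mathbb{Z}_p^\times$ denotes the set of nonzero (invertible) residues modulo $p$, and in the affine automorphism $x\mapsto ux+v$ of $\mathbb{Z}_p$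 one has $v\in\mathbb{Z}_p$.
   Formalization: The color class of size m is shown to be an arc only up to an affine automorphism x↦ux+v (an arithmetic progression); a literal arc is false, e.g. p=11, k=2 with classes {0,2,4,6,8,10} and {1,3,5,7,9}. *)

(* Defs.v *)
From HB Require Import structures.
From mathcomp Require Import all_boot all_order all_algebra.

Set Implicit Arguments.
Unset Strict Implicit.
Unset Printing Implicit Defensive.

Import Order.TTheory GRing.Theory Num.Theory.
Local Open Scope ring_scope.

(* 'Z_n is the ring of residues modulo n only for 1 < n. *)
Definition restricted_sumset n (A : {set 'Z_n}) : {set 'Z_n} :=
  [set a + a' | a in A, a' in A & a != a'].

(* A k-coloring, i.e. an ordered decomposition of 'Z_n into k pairwise disjoint
   (possibly empty) sets, is encoded by the function sending each residue to
   the index of the part that contains it. *)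
Definition coloring (n k : nat) : Type := {ffun 'Z_n -> 'I_k}.

Definition color_class n k (c : coloring n k) (i : 'I_k) : {set 'Z_n} :=
  [set x | c x == i].

Definition coloring_value n k (c : coloring n k) : nat :=
  \max_(i < k) #|restricted_sumset (color_class c i)|.

(* The default #|'Z_n| bounds every coloring value, so it does not affect the
   minimum as soon as some coloring exists, i.e. as soon as 0 < k; see
   Phi_hat_attained. *)
Definition Phi_hat (k n : nat) : nat :=
  \big[minn/#|{: 'Z_n}|]_(c : {ffun 'Z_n -> 'I_k}) coloring_value c.

Definition optimal n k (c : coloring n k) : Prop :=
  coloring_value c = Phi_hat k n.

Definition is_arc n (A : {set 'Z_n}) : Prop :=
  exists (a : 'Z_n) (l : nat), A = [set a + j%:R | j : 'I_l].

Definition affine_image n (u v : 'Z_n) (A : {set 'Z_n}) : {set 'Z_n} :=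
  [set u * x + v | x in A].

(* Restricted sumset sizes are invariant under affine automorphisms, but arcs
   are not preserved by dilations: for n = 11, {0,2,4,6,8,10} and {1,3,5,7,9}
   form an optimal 2-coloring, being a dilation of a coloring by two arcs, but
   neither class is an arc. *)
Definition arc_up_to_affine n (A : {set 'Z_n}) : Prop :=
  exists u v : 'Z_n, u \is a GRing.unit /\ is_arc (affine_image u v A).

Lemma Phi_hat_le n k (c : coloring n k) : (Phi_hat k n <= coloring_value c)%N.
Proof.
rewrite /Phi_hat; have := mem_index_enum c.
elim: (index_enum _) => // d s IH; rewrite big_cons inE => /predU1P[<-|/IH].
  exact: geq_minl.
by apply: leq_trans; exact: geq_minr.
Qed.

Lemma Phi_hat_attained n k :
  (0 < k)%N -> exists c : coloring n k, optimal c.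
Proof.
case: k => // k _; rewrite /optimal.
pose c0 : coloring n k.+1 := [ffun=> ord0].
case: (arg_minnP (@coloring_value n k.+1) (erefl : xpredT c0)) => c _ cmin.
exists c; apply/eqP; rewrite eqn_leq Phi_hat_le andbT /Phi_hat.
elim/big_ind: _ => [|x y lx ly|d _]; last exact: cmin.
  by apply/bigmax_leqP => i _; exact: max_card.
by rewrite leq_min lx.
Qed.

(* Main.v *)
(* Every class with at least m elements is controlled by the polynomial method,
   so the point is Karolyi's inverse theorem: if |A| = k >= 5, 2k - 3 < p and
   the restricted sums of A lie in a set C of size n = 2k - 3, then A is an
   arithmetic progression.
   Let w_x be the inverse of the product of x - y over y in A \ {x}, and let H_v
   be the sum of the w_x x^(k-1+v); then H_0 = 1, the moments below k - 1 vanish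
   (Lagrange interpolation), and the H_v with v <= k determine A (Newton
   recursion).  Put q = prod_(c in C) (X - c).  As (x - y) q(x + y) vanishes on
   A x A, its w-weighted sum against x^s y^t is zero.  The component of
   weight j = s + t of this identity only involves S_u = q_(n-u) and H_v with
   u, v <= j, and is affine in (S_j, H_j).  For 3 <= j <= k a few of these
   equations force (S_j, H_j) to be determined by the lower terms, because their
   determinant is a product of nonzero integers smaller than p: for j < k it is
   'C(2k-2, k-1+j) * 6 j (j-2) (j+1) (k-1), and for j = k it is
   'C(2k-2, k) * 4 k (k-3) (k-4) (k+1).  Hence A, once centred so that H_1 = 0,
   is determined by H_2.  Over an algebraic closure some dilate of the centred
   progression 0, ..., k-1 has the same H_2, so it equals A, and the ratio of the
   dilation lies in F_p because it is a difference of elements of A.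
   The component of weight 0, for smaller C, is the Erdos-Heilbronn bound. *)

Require Import Defs.
From HB Require Import structures.
From mathcomp Require Import all_boot all_order all_algebra all_field.
From mathcomp Require Import ring zify.

Set Implicit Arguments.
Unset Strict Implicit.
Unset Printing Implicit Defensive.

Import Order.TTheory GRing.Theory Num.Theory.
Local Open Scope ring_scope.

(* Proves x = 0 from E : a = b when x = a - b is a ring identity. *)
Ltac linear_combination E :=
  match type of E with ?A = ?B =>
    apply: (@addIr _ B); transitivity A; [ring | transitivity B; [exact: E | ring]] end.

Section Field.
Variable F : fieldType.
Implicit Types (A C : seq F) (k m n i j a u v : nat) (S H : nat -> F).

(** * Coefficients of (x - y)(x + y)^m *)

Lemma natf_dvdn_neq0 m n : (m %| n)%N -> n%:R != 0 :> F -> m%:R != 0 :> F.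
Proof. by case/dvdnP=> d ->; rewrite natrM mulf_eq0 negb_or => /andP[]. Qed.

Lemma bin_dvd_fact n m i : (i <= m <= n)%N -> ('C(m, i) %| n`!)%N.
Proof.
case/andP=> im mn; rewrite -(bin_fact mn) dvdn_mull // dvdn_mulr //.
by rewrite -(bin_fact im) dvdn_mulr.
Qed.

Definition altbin m i : F := (if i is i'.+1 then 'C(m, i')%:R else 0) - 'C(m, i)%:R.

Lemma subXaddX (x y : F) m :
  (x - y) * (x + y) ^+ m
  = \sum_(i < m.+2) altbin m i * x ^+ i * y ^+ (m.+1 - i).
Proof.
have binE : (x + y) ^+ m = \sum_(i < m.+1) 'C(m, i)%:R * x ^+ i * y ^+ (m - i).
  rewrite addrC exprDn; apply: eq_bigr => i _.
  by rewrite -mulr_natl; ring.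
rewrite mulrBl; under [RHS]eq_bigr do rewrite 2!mulrBl.
rewrite sumrB; congr (_ - _).
  rewrite big_ord_recl /= !mul0r add0r binE mulr_sumr.
  by apply: eq_bigr => i _; rewrite /bump /= add1n subSS exprS; ring.
rewrite big_ord_recr /= bin_small // !mul0r addr0 binE mulr_sumr.
apply: eq_bigr => i _; rewrite subSn ?exprS; last by rewrite -ltnS.
by ring.
Qed.

(** The factor m + 1 turns a difference of binomials into a product, whose zeros in [F] can be read
    off its factors. *)
Lemma altbinE m i : (i <= m.+1)%N ->
  m.+1%:R * altbin m i = 'C(m.+1, i)%:R * (i%:R *+ 2 - m.+1%:R).
Proof.
move=> le_im; rewrite /altbin mulrBr.
have -> : m.+1%:R * 'C(m, i)%:R = (m.+1%:R - i%:R) * 'C(m.+1, i)%:R :> F.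
  by rewrite -natrB // -!natrM mul_bin_down.
case: i le_im => [|i] le_im; first by rewrite bin0; ring.
by rewrite -natrM mul_bin_diag natrM; ring.
Qed.

(** * Lagrange weights, moments and moment equations *)

Definition weight A x : F := (\prod_(y <- A | y != x) (x - y))^-1.

(** The polynomial equals its Lagrange interpolant on [A], a combination of monic polynomials of
    degree |A| - 1; compare coefficients in that degree. *)
Lemma lagrange_lead A (p : {poly F}) : uniq A -> (size p <= size A)%N ->
  \sum_(x <- A) weight A x * p.[x] = p`_(size A).-1.
Proof.
move=> uA sp.
pose c x : {poly F} := \prod_(y <- A | y != x) ('X - y%:P).
have cE x : x \in A -> size (c x) = size A /\ (c x)`_(size A).-1 = 1.
  move=> xA; have sc : size (c x) = size A.
    rewrite /c -big_filter size_prod_XsubC size_filter.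
    have := count_predC (pred1 x) A.
    by rewrite count_uniq_mem // xA add1n.
  split=> //; have /monicP : c x \is monic.
    by rewrite /c -big_filter monic_prod_XsubC.
  by rewrite /lead_coef sc.
pose L := \sum_(x <- A) (weight A x * p.[x]) *: c x.
have sL : (size L <= size A)%N.
  rewrite /L big_seq; elim/big_ind: _ => [|P Q sP sQ|x /cE[sc _]].
  - by rewrite size_poly0.
  - by rewrite (leq_trans (size_polyD _ _)) // geq_max sP.
  - by rewrite (leq_trans (size_scale_leq _ _)) ?sc.
suff eLp : L = p.
  rewrite -[in RHS]eLp coef_sum; apply: eq_big_seq => x xA.
  by rewrite coefZ (cE _ xA).2 mulr1.
apply/subr0_eq; apply: (roots_geq_poly_eq0 _ uA); last first.
  by rewrite (leq_trans (size_polyD _ _)) // geq_max sL size_polyN.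
apply/allP=> x xA; rewrite /root hornerD hornerN subr_eq0 /L horner_sum.
rewrite (bigD1_seq x) //= big1_seq ?addr0 => [|y /andP[yx yA]].
  rewrite hornerZ /c horner_prod mulrAC.
  under [X in _ * X * _]eq_bigr do rewrite hornerXsubC.
  rewrite mulVf ?mul1r // prodf_seq_neq0; apply/allP=> y _.
  by rewrite subr_eq0 eq_sym; apply/implyP.
rewrite hornerZ /c horner_prod [X in _ * X](_ : _ = 0) ?mulr0 //.
apply/eqP; rewrite prodf_seq_eq0; apply/hasP; exists x => //.
by rewrite eq_sym yx hornerXsubC subrr /=.
Qed.

Lemma weight_sum_pow A n : uniq A -> (n < size A)%N ->
  \sum_(x <- A) weight A x * x ^+ n = (n == (size A).-1)%:R.
Proof.
move=> uA lt_nA; have := lagrange_lead (p := 'X^n) uA.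
rewrite size_polyXn coefXn eq_sym => <- //.
by apply: eq_bigr => x _; rewrite hornerXn.
Qed.

Definition moment A n : F := \sum_(x <- A) weight A x * x ^+ n.

Definition covers_restricted_sums C A :=
  {in A &, forall x y, x != y -> x + y \in C}.

Lemma moment_equation A C s t : covers_restricted_sums C A ->
  \sum_(m < (size C).+1) (\prod_(c <- C) ('X - c%:P))`_m *
     (\sum_(i < m.+2) altbin m i * moment A (s + i) * moment A (t + (m.+1 - i)))
  = 0.
Proof.
set q := \prod_(c <- C) _ => covAC.
pose T m i x y : F := q`_m * (altbin m i * (weight A x * x ^+ (s + i))
  * (weight A y * y ^+ (t + (m.+1 - i)))).
transitivity (\sum_(x <- A) \sum_(y <- A)
    \sum_(m < (size C).+1) \sum_(i < m.+2) T m i x y).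
  rewrite [RHS](eq_bigr _ (fun x _ => exchange_big _ _ _ _ _ _)) exchange_big /=.
  apply: eq_bigr => m _.
  rewrite [RHS](eq_bigr _ (fun x _ => exchange_big _ _ _ _ _ _)) exchange_big /=.
  rewrite mulr_sumr; apply: eq_bigr => i _.
  rewrite -mulrA big_distrlr /= !mulr_sumr; apply: eq_bigr => x _.
  by rewrite !mulr_sumr; apply: eq_bigr => y _; rewrite /T -!mulrA.
rewrite big_seq big1 // => x xA; rewrite big_seq big1 // => y yA.
transitivity (weight A x * weight A y * x ^+ s * y ^+ t * ((x - y) * q.[x + y])).
  rewrite horner_coef size_prod_XsubC !mulr_sumr; apply: eq_bigr => m _.
  rewrite (mulrCA (x - y)) subXaddX !mulr_sumr; apply: eq_bigr => i _.
  by rewrite /T !exprD; ring.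
(* The factor x - y kills the diagonal, so only sums of distinct elements have to be roots of
   [q]. *)
have [->|xy] := eqVneq x y; first by rewrite subrr mul0r mulr0.
have /rootP -> : root q (x + y) by rewrite root_prod_XsubC covAC.
by rewrite !mulr0.
Qed.

(** * Splitting the moment equations by weight *)

Lemma moment_low A n : uniq A -> (n < (size A).-1)%N -> moment A n = 0.
Proof.
move=> uA ltn; rewrite /moment weight_sum_pow //; last by lia.
by rewrite (ltn_eqF ltn).
Qed.

Lemma moment_lead A : uniq A -> (0 < size A)%N -> moment A (size A).-1 = 1.
Proof. by move=> uA A0; rewrite /moment weight_sum_pow ?eqxx // prednK. Qed.

(* The component of weight j of the moment equation for s = k - 1 - a, with
   S u in the role of the coefficient of degree n - u of q. *)
Definition level_sum n S H j a : F :=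
  \sum_(u < j.+1) \sum_(v < (j - u).+1)
    S u * altbin (n - u) (a + v) * H v * H (j - u - v)%N.

(** With s = k - 1 - a and t = a + j + k - 2 - n, the bound a < k means s >= 0 and the last bound t
    >= 0, while a + j <= n + 1 keeps each index a + v inside the expansion. [S] and [H] are
    arbitrary, so that solutions not coming from a set can be compared too. *)
Definition level_system k n S H :=
  [/\ S 0 = 1, H 0 = 1
    & forall j a, (j <= n)%N -> (a < k)%N -> (a + j <= n.+1)%N ->
        (n.+1 < a + j + k)%N -> level_sum n S H j a = 0].

Definition rev_coef C u : F := (\prod_(c <- C) ('X - c%:P))`_(size C - u).

(** For nonempty [A] with distinct entries, this is the complete homogeneous symmetric polynomial of
    degree v. *)
Definition high_moment A v : F := moment A ((size A).-1 + v).

Lemma rev_coef0 C : rev_coef C 0 = 1.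
Proof.
have /monicP : \prod_(c <- C) ('X - c%:P) \is monic by exact: monic_prod_XsubC.
by rewrite /rev_coef subn0 /lead_coef size_prod_XsubC.
Qed.

Lemma high_moment0 A : uniq A -> (0 < size A)%N -> high_moment A 0 = 1.
Proof. by move=> uA A0; rewrite /high_moment addn0 moment_lead. Qed.

(** In the term of degree n - u of [q] the degrees of the two moments add up to 2(k - 1) + j - u.
    For u > j one of them is below k - 1 and the term vanishes; for u <= j only the indices i = a +
    v with v <= j - u survive. *)
Lemma level_system_of_cover A C : uniq A -> (0 < size A)%N ->
  covers_restricted_sums C A ->
  level_system (size A) (size C) (rev_coef C) (high_moment A).
Proof.
move=> uA A0 covAC; split.
- exact: rev_coef0.
- exact: high_moment0.
move=> j a; set n := size C; set k := size A => lejn ltak leajn ltn.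
have := moment_equation (k.-1 - a) (a + j + k.-1 - n.+1) covAC.
rewrite -/n; set q := \prod_(c <- C) _ => E; rewrite -[RHS]E {E}.
rewrite [RHS](reindex_inj rev_ord_inj) /=.
rewrite -(big_mkord xpredT (fun u => q`_(n.+1 - u.+1) *
  (\sum_(i < (n.+1 - u.+1).+2) altbin (n.+1 - u.+1) i *
     moment A (k.-1 - a + i) *
     moment A (a + j + k.-1 - n.+1 + ((n.+1 - u.+1).+1 - i))))).
rewrite (@big_cat_nat _ _ _ j.+1) //=.
rewrite [X in _ = _ + X]big_nat_cond [X in _ = _ + X]big1 ?addr0; last first.
  move=> u /andP[/andP[ltju ltun] _]; rewrite big1 ?mulr0 // => i _.
  have [lti|gei] := ltnP (k.-1 - a + i) k.-1.
    by rewrite [moment A (_ - a + i)]moment_low // mulr0 mul0r.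
  have := ltn_ord i.
  by move=> lti; rewrite [X in _ * X]moment_low ?mulr0 // -/k; lia.
rewrite big_mkord; apply: eq_bigr => -[u /= ltuj] _.
rewrite subSS.
rewrite -(big_mkord xpredT (fun i => altbin (n - u) i *
     moment A (k.-1 - a + i) *
     moment A (a + j + k.-1 - n.+1 + ((n - u).+1 - i)))).
rewrite (@big_cat_nat _ _ _ a) //=; last by lia.
rewrite [X in _ = _ * (X + _)]big_nat_cond [X in _ = _ * (X + _)]big1 ?add0r;
  last first.
  move=> i /andP[ltia _].
  by rewrite [moment A (_ - a + i)]moment_low ?mulr0 ?mul0r // -/k; lia.
rewrite (@big_cat_nat _ _ _ (a + (j - u).+1)) /=; [|lia|lia].
rewrite [X in _ = _ * (_ + X)]big_nat_cond [X in _ = _ * (_ + X)]big1 ?addr0;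
  last first.
  move=> i /andP[/andP[lei lti] _].
  by rewrite [X in _ * X]moment_low ?mulr0 // -/k; lia.
rewrite -[X in index_iota X _]add0n big_addn addKn big_mkord mulr_sumr.
apply: eq_bigr => -[v /= ltv] _.
rewrite /rev_coef /high_moment -/n -/q -/k -!mulrA; congr (_ * (_ * _)).
  by rewrite addnC.
by congr (moment A _ * moment A _); lia.
Qed.

(** [S j] occurs only at u = j, and [H j] only at u = 0 with v = 0 or v = j; all other terms have
    lower indices and cancel. *)
Lemma level_sumB n S H S' H' j a :
  S 0 = 1 -> H 0 = 1 -> S' 0 = 1 -> H' 0 = 1 -> (0 < j)%N ->
  (forall i, (i < j)%N -> S i = S' i /\ H i = H' i) ->
  level_sum n S H j a - level_sum n S' H' j a =
    (S j - S' j) * altbin (n - j) a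
    + (H j - H' j) * (altbin n a + altbin n (a + j)).
Proof.
move=> S0 H0 S'0 H'0; case: j => // j _ agree.
have top S1 H1 : S1 0 = 1 -> H1 0 = 1 -> level_sum n S1 H1 j.+1 a
  = S1 j.+1 * altbin (n - j.+1) a
    + H1 j.+1 * (altbin n a + altbin n (a + j.+1))
    + (\sum_(v < j) altbin n (a + v.+1) * H1 v.+1 * H1 (j - v)%N
       + \sum_(u < j) \sum_(v < (j - u).+1)
          S1 u.+1 * altbin (n - u.+1) (a + v) * H1 v * H1 (j - u - v)%N).
  move=> S10 H10; rewrite /level_sum big_ord_recl [X in _ + X = _]big_ord_recr /=.
  rewrite /bump /= !add1n !subnn !subn0 big_ord1 S10. 
  rewrite big_ord_recl big_ord_recr /= !subn0 subnn !addn0 H10.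
  under eq_bigr do rewrite mul1r /bump /= add1n subSS.
  under [X in _ + (X + _) = _]eq_bigr do rewrite add1n subSS.
  by rewrite /bump /= add1n; ring.
rewrite !top //.
set R := (X in _ + X - _); set R' := (X in _ - (_ + X)).
suff -> : R = R' by ring.
rewrite {}/R {}/R'; congr (_ + _); apply: eq_bigr => -[u /= ltu] _.
  by rewrite !(agree _ _).2 //; lia.
apply: eq_bigr => -[v /= ltv] _.
by rewrite (agree u.+1 _).1 ?(agree v _).2 ?(agree (j - u - v)%N _).2 //; lia.
Qed.

(** * Elimination in the level equations *)

Section Determinants.
Variables K J s g : F.

(** Here c, f, e stand for 'C(2k-2-j, a), 'C(2k-2, a), 'C(2k-2, a+j), numbered 0, 1, 2 for a = k-1,
    k-2, k-3. Q0 (divided by j), Q1, Q2 are the level equations, and R1 to R5 relate neighbouring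
    binomials. No f0 appears, its factor 2a - (2k-2) being zero. *)
Lemma level_det (c0 c1 c2 f1 f2 e0 e1 e2 : F) :
  2%:R != 0 :> F ->
  s * c0 + g * (e0 *+ 2) = 0 ->
  s * (c1 * (J - 2)) + g * (f1 * (-2) + e1 * (J *+ 2 - 2)) = 0 ->
  s * (c2 * (J - 4)) + g * (f2 * (-4) + e2 * (J *+ 2 - 4)) = 0 ->
  c1 * (K - J) = c0 * (K - 1) -> c2 * (K - J + 1) = c1 * (K - 2) ->
  f2 * (K + 1) = f1 * (K - 2) ->
  e1 * (K - J) = e0 * (K - 1 + J) -> e2 * (K - J + 1) = e1 * (K - 2 + J) ->
  g * e0 * (6 * J * (J - 2) * (J + 1) * (K - 1)) = 0.
Proof.
move=> n2 Q0 Q1 Q2 R1 R2 R3 R4 R5.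
(* Eliminating s between Q0 and Q1 gives twice this relation. *)
have P1 : g * f1 * (K - J) - g * e0 * (K + J ^+ 2 - J - 1) = 0.
  apply: (mulfI n2).
  have E := congr1 ( *%R (- (K - J))) Q1.
  have {}E := f_equal2 +%R E (congr1 ( *%R (s * (J - 2))) R1).
  have {}E := f_equal2 +%R E (congr1 ( *%R ((K - 1) * (J - 2))) Q0).
  have {}E := f_equal2 +%R E (congr1 ( *%R (g * (J *+ 2 - 2))) R4).
  linear_combination E.
have E := congr1 ( *%R ((K - J) * (K - J + 1) * (K + 1))) Q2.
have {}E := f_equal2 +%R E (congr1 ( *%R (- s * (J - 4) * (K - J) * (K + 1))) R2).
have {}E := f_equal2 +%R E (congr1 ( *%R (- s * (J - 4) * (K - 2) * (K + 1))) R1).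
have {}E :=
  f_equal2 +%R E (congr1 ( *%R (- (J - 4) * (K - 1) * (K - 2) * (K + 1))) Q0).
have {}E := f_equal2 +%R E (congr1 ( *%R (4 * g * (K - J) * (K - J + 1))) R3).
have {}E := f_equal2 +%R E (congr1 ( *%R (4 * (K - 2) * (K - J + 1))) P1).
have {}E :=
  f_equal2 +%R E (congr1 ( *%R (- g * (J *+ 2 - 4) * (K - J) * (K + 1))) R5).
have {}E :=
  f_equal2 +%R E (congr1 ( *%R (- g * (J *+ 2 - 4) * (K - 2 + J) * (K + 1))) R4).
linear_combination E.
Qed.

(** For j = k the index a = k - 1 is out of range, but a = 0, 1, 2 are allowed and give explicit
    binomials. [X], [X1], [X2] stand for 'C(2k-2, k), 'C(2k-2, k+1), 'C(2k-2, k+2). *)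
Lemma last_level_det (c2 n2 X X1 X2 : F) (N := K *+ 2 - 2) :
  s * (2 - K) + g * (X *+ 2 - N) = 0 ->
  s * ((K - 2) * (4 - K)) + g * (N * (2 - N) + X1 *+ 4) = 0 ->
  s * (c2 * (6 - K)) + g * (n2 * (4 - N) + X2 *+ 6) = 0 ->
  c2 *+ 2 = (K - 2) * (K - 3) -> n2 *+ 2 = N * (N - 1) ->
  X1 * (K + 1) = X * (K - 2) -> X2 * (K + 2) = X1 * (K - 3) ->
  g * X * (4 * K * (K - 3) * (K - 4) * (K + 1)) = 0.
Proof.
rewrite {}/N => Z0 Z1 Z2 Rc Rn R1 R2.
(* [V1] and [V2] are free of s; their final combination also loses the terms without [X]. *)
have V1 := congr1 ( *%R (K + 1)) Z1.
have {}V1 := f_equal2 +%R V1 (congr1 ( *%R (- (K + 1) * (K - 4))) Z0).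
have {}V1 := f_equal2 +%R V1 (congr1 ( *%R (- 4 * g)) R1).
have V2 := congr1 ( *%R ((K + 1) * (K + 2) * 2)) Z2.
have {}V2 :=
  f_equal2 +%R V2 (congr1 ( *%R (- (K + 1) * (K + 2) * (K - 3) * (K - 6))) Z0).
have {}V2 := f_equal2 +%R V2 (congr1 ( *%R (- s * (6 - K) * (K + 1) * (K + 2))) Rc).
have {}V2 :=
  f_equal2 +%R V2 (congr1 ( *%R (- g * (6 - K *+ 2) * (K + 1) * (K + 2))) Rn).
have {}V2 := f_equal2 +%R V2 (congr1 ( *%R (- 12 * g * (K + 1))) R2).
have {}V2 := f_equal2 +%R V2 (congr1 ( *%R (- 12 * g * (K - 3))) R1).
have E := f_equal2 +%R V2 (congr1 ( *%R (- 3 * (K - 3) * (K + 2))) V1).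
linear_combination E.
Qed.
End Determinants.
Lemma natrB_eq (x y z : nat) : x = (y + z)%N -> x%:R - y%:R = z%:R :> F.
Proof. by move=> ->; rewrite natrD addrC addKr. Qed.

(** * Uniqueness of solutions of the level system *)

Section Uniqueness.
Variable k : nat.
Hypothesis fact_neq0 : ((2 * k - 2)`!)%:R != 0 :> F.

Lemma small_natf_neq0 i : (0 < i <= 2 * k - 2)%N -> i%:R != 0 :> F.
Proof. by move=> hi; apply: natf_dvdn_neq0 fact_neq0; apply: dvdn_fact. Qed.

Lemma small_bin_neq0 m i : (i <= m <= 2 * k - 2)%N -> 'C(m, i)%:R != 0 :> F.
Proof. by move=> hi; apply: natf_dvdn_neq0 fact_neq0; apply: bin_dvd_fact. Qed.

(** The equations at a = k-1, k-2, k-3 feed [level_det]. Its factor j - 2 has to vanish at j = 2,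
    where dilations leave [H 2] free; hence the start at j = 3. *)
Lemma mid_level_vanish j (s g : F) : (3 <= j < k)%N ->
  (forall a, (a < k)%N -> (a + j <= 2 * k - 2)%N -> (2 * k - 2 < a + j + k)%N ->
    s * ('C(2 * k - 2 - j, a)%:R * (a%:R *+ 2 - (2 * k - 2 - j)%:R))
    + g * ('C(2 * k - 2, a)%:R * (a%:R *+ 2 - (2 * k - 2)%:R)
       + 'C(2 * k - 2, a + j)%:R * ((a + j)%:R *+ 2 - (2 * k - 2)%:R)) = 0) ->
  g = 0.
Proof.
move=> /andP[le3j ltjk] eqs.
have [r kE] : exists r, k = r.+3 by exists (k - 3)%N; lia.
have E0 := eqs r.+2; have E1 := eqs r.+1; have E2 := eqs r.
have nE : (2 * k - 2 = 2 * r + 4)%N by lia.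
have nN : (2 * k - 2)%:R = r%:R *+ 2 + 4 :> F by rewrite nE; ring.
have mN : (2 * k - 2 - j)%:R = r%:R *+ 2 + 4 - j%:R :> F.
  by rewrite natrB ?nN //; lia.
have nz i := @small_natf_neq0 i.
have bnz : 'C(2 * k - 2, r.+2 + j)%:R != 0 :> F by apply: small_bin_neq0; lia.
rewrite nN mN in E0 E1 E2.
have left m i x y : i.+1 = x -> (m - i)%N = y ->
   'C(m, i)%:R * y%:R = 'C(m, x)%:R * x%:R :> F.
  by move=> <- <-; rewrite -!natrM mulnC -mul_bin_left mulnC.
have n2 : 2%:R != 0 :> F by apply: nz; lia.
have nj : j%:R != 0 :> F by apply: nz; lia.
have kjN : r.+3%:R - j%:R = (k - j)%:R :> F by rewrite kE natrB //; lia.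
have kj1N : r.+3%:R - j%:R + 1 = (k - j).+1%:R :> F by rewrite kjN; ring.
have D : g * 'C(2 * k - 2, r.+2 + j)%:R *
    (6 * j%:R * (j%:R - 2) * (j%:R + 1) * (r.+3%:R - 1)) = 0.
  apply: (@level_det r.+3%:R j%:R s g 'C(2 * k - 2 - j, r.+2)%:R
    'C(2 * k - 2 - j, r.+1)%:R 'C(2 * k - 2 - j, r)%:R
    'C(2 * k - 2, r.+1)%:R 'C(2 * k - 2, r)%:R 'C(2 * k - 2, r.+2 + j)%:R
    'C(2 * k - 2, r.+1 + j)%:R 'C(2 * k - 2, r + j)%:R) => //.
  - by apply: (mulfI nj); rewrite mulr0 -[RHS]E0 ?kE; [ring|lia..].
  - by rewrite -[RHS]E1 ?kE; [ring|lia..].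
  - by rewrite -[RHS]E2 ?kE; [ring|lia..].
  - rewrite kjN (_ : r.+3%:R - 1 = r.+2%:R); last by ring.
    by apply: left; lia.
  - rewrite kj1N (_ : r.+3%:R - 2 = r.+1%:R); last by ring.
    by apply: left; lia.
  - rewrite (_ : r.+3%:R + 1 = r.+4%:R); last by ring.
    rewrite (_ : r.+3%:R - 2 = r.+1%:R); last by ring.
    by apply: left; lia.
  - rewrite kjN (_ : r.+3%:R - 1 + j%:R = (r.+2 + j)%:R); last by ring.
    by apply: left; lia.
  - rewrite kj1N (_ : r.+3%:R - 2 + j%:R = (r.+1 + j)%:R); last by ring.
    by apply: left; lia.
have {}D : g * ('C(2 * k - 2, r.+2 + j)%:R *
    (2%:R * 3%:R * j%:R * (j - 2)%:R * j.+1%:R * r.+2%:R)) = 0.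
  by rewrite -[RHS]D natrB; [ring | lia].
move/eqP: D; rewrite mulf_eq0 => /orP[/eqP //|/idPn[]].
by rewrite !mulf_neq0 // nz; lia.
Qed.

Lemma last_level_vanish (s g : F) : (5 <= k)%N ->
  (forall a, (a < k)%N -> (a + k <= 2 * k - 2)%N -> (2 * k - 2 < a + k + k)%N ->
    s * ('C(2 * k - 2 - k, a)%:R * (a%:R *+ 2 - (2 * k - 2 - k)%:R))
    + g * ('C(2 * k - 2, a)%:R * (a%:R *+ 2 - (2 * k - 2)%:R)
       + 'C(2 * k - 2, a + k)%:R * ((a + k)%:R *+ 2 - (2 * k - 2)%:R)) = 0) ->
  g = 0.
Proof.
move=> le5k eqs.
have [r kE] : exists r, k = r.+4.+1 by exists (k - 5)%N; lia.
have E0 := eqs 0; have E1 := eqs 1; have E2 := eqs 2.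
have nE : (2 * k - 2 = 2 * r + 8)%N by lia.
have nN : (2 * k - 2)%:R = r%:R *+ 2 + 8 :> F by rewrite nE; ring.
have mE : (2 * k - 2 - k = r.+3)%N by lia.
have nz i := @small_natf_neq0 i.
have bnz : 'C(2 * k - 2, k)%:R != 0 :> F by apply: small_bin_neq0; lia.
have left m i x y : i.+1 = x -> (m - i)%N = y ->
   'C(m, x)%:R * x%:R = 'C(m, i)%:R * y%:R :> F.
  by move=> <- <-; rewrite -!natrM mulnC mul_bin_left mulnC.
rewrite mE nN ?add0n ?add1n ?add2n !(bin0, bin1) in E0 E1 E2.
have D : g * 'C(2 * k - 2, k)%:R *
    (4 * k%:R * (k%:R - 3) * (k%:R - 4) * (k%:R + 1)) = 0.
  apply: (@last_level_det k%:R s g 'C(r.+3, 2)%:R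
    'C(2 * k - 2, 2)%:R 'C(2 * k - 2, k)%:R 'C(2 * k - 2, k.+1)%:R
    'C(2 * k - 2, k.+2)%:R).
  - by rewrite -[RHS]E0 ?kE; [ring|lia..].
  - by rewrite -[RHS]E1 ?nN ?kE; [ring|lia..].
  - by rewrite -[RHS]E2 ?kE; [ring|lia..].
  - by rewrite -[LHS]mulr_natr (left _ 1 _ r.+2) // bin1 kE; ring.
  - rewrite -[LHS]mulr_natr (left _ 1 _ (2 * k - 2 - 1)%N) // bin1.
    rewrite [(_ - 1)%:R]natrB; last by lia.
    by rewrite nN kE; ring.
  - rewrite (_ : k%:R + 1 = k.+1%:R); last by ring.
    by rewrite (left _ k _ r.+3) ?kE //; [ring | lia].
  - rewrite (_ : k%:R + 2 = k.+2%:R); last by ring.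
    by rewrite (left _ k.+1 _ r.+2) ?kE //; [ring | lia].
have {}D : g * ('C(2 * k - 2, k)%:R *
    (4%:R * k%:R * (k - 3)%:R * (k - 4)%:R * k.+1%:R)) = 0.
  by rewrite -[RHS]D !natrB; [ring | lia..].
move/eqP: D; rewrite mulf_eq0 => /orP[/eqP //|/idPn[]].
by rewrite !mulf_neq0 // nz; lia.
Qed.

Theorem level_system_unique S H S' H' : (5 <= k)%N ->
  level_system k (2 * k - 3) S H -> level_system k (2 * k - 3) S' H' ->
  H 1 = H' 1 -> H 2 = H' 2 ->
  forall j, (j <= k)%N -> S j = S' j /\ H j = H' j.
Proof.
move=> le5k [S0 H0 sys] [S'0 H'0 sys'] H1 H2.
elim/ltn_ind => -[|j'] IH lejk; first by rewrite S0 S'0 H0 H'0.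
move: lejk IH; set j := j'.+1 => lejk IH.
have nz i := @small_natf_neq0 i.
have nE : (2 * k - 3).+1 = (2 * k - 2)%N by lia.
have mE : (2 * k - 3 - j).+1 = (2 * k - 2 - j)%N by lia.
(* The divisors absorb the factors m + 1 of [altbinE]. *)
pose s := (S j - S' j) / (2 * k - 2 - j)%:R.
pose g := (H j - H' j) / (2 * k - 2)%:R.
have nN : (2 * k - 2)%:R != 0 :> F by apply: nz; lia.
have mN : (2 * k - 2 - j)%:R != 0 :> F by apply: nz; lia.
have eqs a : (a < k)%N -> (a + j <= 2 * k - 2)%N -> (2 * k - 2 < a + j + k)%N ->
    s * ('C(2 * k - 2 - j, a)%:R * (a%:R *+ 2 - (2 * k - 2 - j)%:R))
    + g * ('C(2 * k - 2, a)%:R * (a%:R *+ 2 - (2 * k - 2)%:R)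
       + 'C(2 * k - 2, a + j)%:R * ((a + j)%:R *+ 2 - (2 * k - 2)%:R)) = 0.
  move=> ak aj jk.
  rewrite -mE -nE -!altbinE; [|lia..].
  rewrite mE nE -mulrDr mulrA (mulrA g) !divfK //.
  rewrite -level_sumB // => [|i ltij]; last by apply: IH; lia.
  by rewrite sys ?sys' ?subrr //; lia.
have g0 : g = 0.
  have [le3j|lt3j] := leqP 3 j; last first.
    rewrite /g (_ : H j = H' j) ?subrr ?mul0r //.
    by have /orP[/eqP->|/eqP->] : (j == 1)%N || (j == 2)%N by lia.
  have [ejk|ltjk] := eqVneq j k.
    by move: eqs; rewrite ejk; apply: last_level_vanish.
  by apply: (@mid_level_vanish j s); [lia | exact: eqs].
have s0 : s = 0.
  (* One equation with g = 0 suffices. At a = k - 1 its factor 2a - (2k-2-j) is j; for j = k that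
     index is out of range, and a = k - 2 gives the factor k - 2. *)
  pose a := (if j == k then k - 2 else k - 1)%N.
  have [ak aj jk] : [/\ (a < k)%N, (a + j <= 2 * k - 2)%N & (2 * k - 2 < a + j + k)%N].
    by rewrite /a; case: eqP; split; lia.
  have /eqP := eqs a ak aj jk; rewrite g0 mul0r addr0 mulf_eq0 => /orP[/eqP//|/idPn[]].
  apply: mulf_neq0.
    by apply: small_bin_neq0; rewrite /a; case: eqP; lia.
  rewrite -mulrnA (natrB_eq (z := if j == k then (k - 2)%N else j)).
    by apply: nz; case: eqP; lia.
  by rewrite /a; case: eqP; lia.
split; apply/eqP; rewrite -subr_eq0.
  by rewrite -[_ - _](divfK mN) -/s s0 mul0r.
by rewrite -[_ - _](divfK nN) -/g g0 mul0r.
Qed.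
End Uniqueness.

(** * Recovering a set from its moments *)

Lemma newton_high_moment A d : uniq A -> (0 < d <= size A)%N ->
  \sum_(u < d.+1) rev_coef A u * high_moment A (d - u)%N = 0.
Proof.
move=> uA /andP[d0 led]; set k := size A; set q := \prod_(y <- A) ('X - y%:P).
(* The polynomial of [A] vanishes on [A], so its weighted sum against x^(d-1) is zero; dropping the
   moments below k - 1 leaves the recursion. *)
transitivity (\sum_(i < k.+1) q`_i * moment A (d.-1 + i)); last first.
  rewrite /moment; under eq_bigr do rewrite mulr_sumr.
  rewrite exchange_big /= big_seq big1 // => x xA.
  transitivity (weight A x * x ^+ d.-1 * q.[x]); last first.
    by have /rootP -> : root q x; rewrite ?mulr0 // root_prod_XsubC.
  rewrite horner_coef size_prod_XsubC mulr_sumr; apply: eq_bigr => i _.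
  by rewrite exprD; ring.
rewrite [RHS](reindex_inj rev_ord_inj) /=.
rewrite -(big_mkord xpredT (fun u => q`_(k.+1 - u.+1) *
  moment A (d.-1 + (k.+1 - u.+1)))).
rewrite (@big_cat_nat _ _ _ d.+1) //=.
rewrite [X in _ = _ + X]big_nat_cond [X in _ = _ + X]big1 ?addr0; last first.
  by move=> u /andP[/andP[ltju ltun] _]; rewrite moment_low ?mulr0 // -/k; lia.
rewrite big_mkord; apply: eq_bigr => -[u /= ltu] _.
rewrite /rev_coef -/k -/q /high_moment subSS; congr (_ * moment A _).
by rewrite -/k; lia.
Qed.

Lemma high_moment1 A : uniq A -> (0 < size A)%N ->
  high_moment A 1 = \sum_(x <- A) x.
Proof.
move=> uA A0; have := newton_high_moment uA (d := 1) A0.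
rewrite big_ord_recl big_ord1 /= rev_coef0 high_moment0 // mul1r mulr1.
rewrite /rev_coef subn1 coefPn_prod_XsubC -?lt0n //.
by move/eqP; rewrite subr_eq0 => /eqP.
Qed.

(** Because [H 0] is 1, the recursion expresses [S d] through [H] and earlier values of [S]. *)
Lemma rev_coef_of_high_moment A S H : uniq A -> (0 < size A)%N -> S 0 = 1 ->
  (forall d, (0 < d <= size A)%N -> \sum_(u < d.+1) S u * H (d - u)%N = 0) ->
  (forall j, (j <= size A)%N -> high_moment A j = H j) ->
  forall d, (d <= size A)%N -> rev_coef A d = S d.
Proof.
move=> uA A0 S0 eqS eqH; elim/ltn_ind => -[|d] IH led.
  by rewrite rev_coef0 S0.
have H0 : H 0 = 1 by rewrite -eqH ?high_moment0.
have := newton_high_moment uA (d := d.+1) led.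
rewrite -[RHS](eqS d.+1 led) big_ord_recr [RHS]big_ord_recr /= subnn.
rewrite H0 high_moment0 // !mulr1.
rewrite (eq_bigr (fun u : 'I_d.+1 => S u * H (d.+1 - u)%N)) => [/addrI //|u _].
have ltu := ltn_ord u.
by rewrite IH ?eqH //; lia.
Qed.

Lemma eq_mem_of_rev_coef A B : size A = size B ->
  (forall d, (d <= size A)%N -> rev_coef A d = rev_coef B d) -> A =i B.
Proof.
move=> eqs eqr x; rewrite -!root_prod_XsubC.
suff -> : \prod_(y <- A) ('X - y%:P) = \prod_(y <- B) ('X - y%:P) by [].
apply/polyP => i; have [lei|lti] := leqP i (size A).
  have := eqr (size A - i)%N (leq_subr _ _).
  by rewrite /rev_coef -eqs subKn.
by rewrite !nth_default // size_prod_XsubC -?eqs.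
Qed.

(** * Critical sets and affine normalisation *)

Lemma high_moment_scale (d : F) A n : uniq A -> d != 0 ->
  high_moment [seq d * x | x <- A] n = d ^+ n * high_moment A n.
Proof.
move=> uA d0; rewrite /high_moment /moment size_map big_map mulr_sumr.
apply: eq_big_seq => x xA.
have -> : weight [seq d * x | x <- A] (d * x) = d ^- (size A).-1 * weight A x.
  rewrite /weight big_map -invfM.
  rewrite (eq_bigl (fun y => y != x)) => [|y]; last by rewrite (inj_eq (mulfI d0)).
  rewrite (eq_bigr (fun y => d * (x - y))) => [|y _]; last by rewrite mulrBr.
  rewrite big_split /= big_const_seq iter_mulr_1; congr ((d ^+ _ * _)^-1).
  have := count_predC (pred1 x) A; rewrite count_uniq_mem // xA add1n => <-.
  by rewrite -pred_Sn; apply: eq_count.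
rewrite exprMn exprD -!mulrA; field.
by rewrite expf_neq0.
Qed.
(** [C] may contain repetitions, so a smaller set of sums can be padded to length exactly 2k - 3. *)
Definition critical k A := [/\ uniq A, size A = k
  & exists2 C, size C = (2 * k - 3)%N & covers_restricted_sums C A].

Lemma critical_affine k A (d t : F) : d != 0 -> critical k A ->
  critical k [seq d * x + t | x <- A].
Proof.
move=> d0 [uA sA [C sC covAC]]; split; rewrite ?size_map //.
  by rewrite map_inj_uniq // => x y /addIr /(mulfI d0).
exists [seq d * c + t *+ 2 | c <- C]; rewrite ?size_map //.
move=> _ _ /mapP[x xA ->] /mapP[y yA ->] xy; apply/mapP.
exists (x + y); last by ring.
by apply: covAC => //; apply: contraNneq xy => ->.
Qed.

Lemma critical_iota k : (2 <= k)%N -> (k`!)%:R != 0 :> F ->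
  critical k [seq i%:R | i <- iota 0 k].
Proof.
move=> le2k k0; split; rewrite ?size_map ?size_iota //.
  rewrite map_inj_in_uniq ?iota_uniq // => i j.
  rewrite !mem_iota !add0n => ltik ltjk.
  wlog ltij : i j ltik ltjk / (i < j)%N.
    move=> IH eqij; have [/IH->|/IH->|] := ltngtP i j => //.
  move=> eqij; have /eqP[] : (j - i)%:R != 0 :> F.
    by apply: natf_dvdn_neq0 k0; apply: dvdn_fact; lia.
  by rewrite natrB ?eqij ?subrr // ltnW.
exists [seq i%:R | i <- iota 1 (2 * k - 3)]; rewrite ?size_map ?size_iota //.
move=> _ _ /mapP[i + ->] /mapP[j + ->].
rewrite !mem_iota => hi hj neq; apply/mapP; exists (i + j)%N; last by rewrite natrD.
by rewrite mem_iota; case: (eqVneq i j) neq => [->|neij _]; [rewrite eqxx | lia].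
Qed.

Lemma critical_center k A : k%:R != 0 :> F -> critical k A ->
  exists t, \sum_(x <- [seq x + t | x <- A]) x = 0.
Proof.
move=> k0 [_ sA _]; exists (- (\sum_(x <- A) x) / k%:R).
rewrite big_map big_split /= big_const_seq count_predT iter_addr_0 sA.
by rewrite -[_ *+ k]mulr_natr divfK // subrr.
Qed.

(** * Rigidity of centred critical sets *)

Section Rigidity.
Variable k : nat.
Hypothesis le5k : (5 <= k)%N.
Hypothesis fact_neq0 : ((2 * k - 2)`!)%:R != 0 :> F.

Lemma critical_system A : critical k A ->
  exists S, level_system k (2 * k - 3) S (high_moment A).
Proof.
move=> [uA sA [C sC covAC]]; exists (rev_coef C); rewrite -sC -sA.
by apply: level_system_of_cover => //; lia.
Qed.

(** These are the formal data of k coinciding elements 0. At level 0 only a = k - 1 is admissible,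
    where 2a - (2k-2) is zero; at higher levels each term has an entry of positive index. *)
Lemma trivial_level_system :
  level_system k (2 * k - 3) (fun i => (i == 0)%:R : F) (fun i => (i == 0)%:R).
Proof.
split=> // j a lejn ltak leaj ltaj.
rewrite /level_sum; case: j lejn leaj ltaj => [|j] lejn leaj ltaj.
  rewrite !big_ord1 /= !mulr1 mul1r subn0 addn0.
  have -> : a = k.-1 by lia.
  have nz : (2 * k - 3).+1%:R != 0 :> F by apply: (small_natf_neq0 fact_neq0); lia.
  apply: (mulfI nz); rewrite mulr0 altbinE; last by lia.
  rewrite -mulrnA (natrB_eq (z := 0)) ?mulr0 //; lia.
rewrite big1 // => -[u ltu] _; rewrite big1 // => -[v ltv] _ /=.
case: u ltu ltv => [|u] ltu ltv; last by rewrite !mul0r.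
case: v ltv => [|v] ltv; last by rewrite mulr0 mul0r.
by rewrite mulr0.
Qed.

(** Otherwise, by uniqueness against the trivial solution, the polynomial of [A] would be X^k and
    all elements would be 0. *)
Lemma centered_critical_neq0 A : critical k A -> \sum_(x <- A) x = 0 ->
  high_moment A 2 != 0.
Proof.
move=> critA sumA; apply/eqP => H2; have [S sysA] := critical_system critA.
have [uA sA _] := critA; have A0 : (0 < size A)%N by lia.
have H1 : high_moment A 1 = 0 by rewrite high_moment1.
have eqH := level_system_unique fact_neq0 le5k sysA trivial_level_system H1 H2.
have eqr d : (d <= size A)%N -> rev_coef A d = (d == 0)%:R.
  apply: (rev_coef_of_high_moment (S := fun i => (i == 0)%:R)
    (H := fun i => (i == 0)%:R)) => // [e /andP[e0 _]|e lee].
    rewrite big1 // => -[[|u] /= ltu] _; last by rewrite mul0r.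
    by rewrite subn0 eqn0Ngt e0 mulr0.
  by rewrite (eqH e _).2 // -sA.
have A00 : {subset A <= [:: 0]}.
  move=> x xA; rewrite inE; have [k0 xk] : (0 < k)%N /\ (x ^+ k == 0 -> x == 0).
    by split=> [|]; [lia | rewrite expf_eq0 => /andP[]].
  apply: xk.
  have <- : (\prod_(y <- A) ('X - y%:P)).[x] = x ^+ k.
    rewrite -hornerXn; congr _.[x]; apply/polyP => i; rewrite coefXn.
    have [lei|lti] := leqP i k; last first.
      by rewrite nth_default ?size_prod_XsubC ?sA // gtn_eqF.
    have := eqr (k - i)%N; rewrite /rev_coef sA subKn // => ->.
      by congr (_%:R); lia.
    exact: leq_subr.
  by rewrite -[_ == 0]/(root _ x) root_prod_XsubC.
by have := uniq_leq_size uA A00; rewrite sA /=; lia.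
Qed.

Lemma centered_critical_eq A B : critical k A -> critical k B ->
  \sum_(x <- A) x = 0 -> \sum_(x <- B) x = 0 ->
  high_moment A 2 = high_moment B 2 -> A =i B.
Proof.
move=> critA critB sumA sumB H2.
have [SA sysA] := critical_system critA; have [SB sysB] := critical_system critB.
have [uA sA _] := critA; have [uB sB _] := critB.
have A0 : (0 < size A)%N by lia.
have B0 : (0 < size B)%N by lia.
have H1 : high_moment A 1 = high_moment B 1 by rewrite !high_moment1 // sumA.
have eqH := level_system_unique fact_neq0 le5k sysA sysB H1 H2.
apply: eq_mem_of_rev_coef => [|d led]; first by rewrite sB.
apply: (rev_coef_of_high_moment (H := high_moment B)) => //.
- exact: rev_coef0.
- by move=> e; rewrite sA -sB; apply: newton_high_moment.
- by move=> e; rewrite sA => /eqH[].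
Qed.
End Rigidity.
End Field.

(** * The inverse theorem over closed and countable fields *)

Theorem critical_closed_field (K : closedFieldType) k (A : seq K) :
  (5 <= k)%N -> ((2 * k - 2)`!)%:R != 0 :> K -> critical k A ->
  exists d t : K, d != 0 /\ A =i [seq d * i%:R + t | i <- iota 0 k].
Proof.
move=> le5k f0 critA.
have k0 : k%:R != 0 :> K by apply: (small_natf_neq0 f0); lia.
have kf0 : (k`!)%:R != 0 :> K.
  apply: natf_dvdn_neq0 f0; have lek : (k <= 2 * k - 2)%N by lia.
  by rewrite -(bin_fact lek) dvdn_mull // dvdn_mulr.
have critI : critical k [seq i%:R : K | i <- iota 0 k].
  by apply: critical_iota => //; lia.
have [t sumA'] := critical_center k0 critA.
have [r sumI'] := critical_center k0 critI.
set I := [seq i%:R : K | i <- iota 0 k] in critI sumI'.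
set A' := [seq x + t | x <- A] in sumA'; set I' := [seq x + r | x <- I] in sumI'.
have shift B y : critical k B -> critical k [seq x + y : K | x <- B].
  move=> /(critical_affine y (oner_neq0 K)).
  by rewrite (eq_map (g := fun x => x + y)) // => x; rewrite mul1r.
have critA' := shift _ t critA; have critI' := shift _ r critI.
have hA := centered_critical_neq0 le5k f0 critA' sumA'.
have hI := centered_critical_neq0 le5k f0 critI' sumI'.
(* The second moment is homogeneous of degree 2, so the ratio of the dilation is a square root. *)
have [d dE] : exists d : K, d ^+ 2 = high_moment A' 2 / high_moment I' 2.
  have [d dE] := solve_monicpoly
    (fun i => if i == 0 then high_moment A' 2 / high_moment I' 2 else 0) (ltn0Sn 1).
  by exists d; rewrite dE big_ord_recl big_ord1 /= mul0r addr0 mulr1.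
have d0 : d != 0.
  apply: contra_eq_neq dE => ->.
  by rewrite expr0n eq_sym mulf_neq0 ?invr_eq0.
have critdI : critical k [seq d * x | x <- I'].
  have -> : [seq d * x | x <- I'] = [seq d * x + 0 | x <- I'].
    by apply: eq_map => x; rewrite addr0.
  exact: critical_affine.
have := centered_critical_eq le5k f0 critA' critdI sumA'.
rewrite big_map -mulr_sumr sumI' mulr0 high_moment_scale; last 2 first.
- by case: critI'.
- by [].
rewrite dE divfK // => /(_ erefl erefl) eqA.
(* The constant term undoes both centring translations. *)
exists d, (d * r - t); split=> // x.
rewrite -(mem_map (addIr t)) -/A' eqA -map_comp -map_comp.
apply/mapP/mapP => -[i hi e]; exists i => //=; move: e => /=.
  by move/(congr1 (fun z => z - t)); rewrite addrK => ->; ring.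
by move=> ->; ring.
Qed.
Theorem critical_countField (F : countFieldType) k (A : seq F) :
  (5 <= k)%N -> ((2 * k - 2)`!)%:R != 0 :> F -> critical k A ->
  exists d t : F, d != 0 /\ A =i [seq d * i%:R + t | i <- iota 0 k].
Proof.
move=> le5k f0 [uA sA [C sC covAC]].
have [K [f _]] := countable_algebraic_closure F.
have critfA : critical k (map f A).
  split; rewrite ?size_map ?(map_inj_uniq (fmorph_inj f)) //.
  exists (map f C); rewrite ?size_map // => _ _ /mapP[x xA ->] /mapP[y yA ->].
  by rewrite (inj_eq (fmorph_inj f)) => xy; rewrite -rmorphD map_f // covAC.
have f0K : ((2 * k - 2)`!)%:R != 0 :> K by rewrite -(rmorph_nat f) fmorph_eq0.
have [d [t [d0 eqA]]] := critical_closed_field le5k f0K critfA.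
have inA i : (i < k)%N -> exists2 a, a \in A & d * i%:R + t = f a.
  move=> ltik; apply/mapP; rewrite eqA; apply/mapP; exists i => //.
  by rewrite mem_iota.
have [a _ ea] := inA 0 (ltn_trans (ltn0Sn 3) le5k).
have [b _ eb] := inA 1 (ltn_trans (isT : 1 < 4)%N le5k).
have tE : t = f a by rewrite -ea mulr0 add0r.
have dE : d = f (b - a) by rewrite rmorphB -eb -ea; ring.
exists (b - a), a; split=> [|x]; first by rewrite -(fmorph_eq0 f) -dE.
rewrite -[LHS](mem_map (fmorph_inj f)) -[RHS](mem_map (fmorph_inj f)) eqA -map_comp.
by congr (_ \in _); apply: eq_map => i /=; rewrite rmorphD rmorphM rmorph_nat -tE -dE.
Qed.

(** * The Erdos-Heilbronn bound and arcs over prime fields *)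

Lemma restricted_cover_bound (F : fieldType) (A C : seq F) : uniq A ->
  covers_restricted_sums C A -> (size A <= size C + 2)%N ->
  ((size C).+1`!)%:R != 0 :> F -> (2 * size A <= size C + 3)%N.
Proof.
move=> uA covAC; set k := size A; set n := size C => lekn f0.
rewrite leqNgt; apply/negP => ltn.
have A0 : (0 < size A)%N by rewrite -/k; lia.
have [S0 H0 sys] := level_system_of_cover uA A0 covAC.
(* The level 0 equation at a = k - 1 makes 'C(n+1, k-1) (2k - 3 - n) vanish. *)
have := sys 0 k.-1; rewrite /level_sum !big_ord1 /= S0 H0 !mulr1 mul1r.
rewrite subn0 addn0 -/k -/n => E.
have {}E : n.+1%:R * altbin F n k.-1 = 0 by rewrite E ?mulr0 //; lia.
move: E; rewrite altbinE; last by lia.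
rewrite -mulrnA (natrB_eq F (z := 2 * k - 3 - n)); last by lia.
move/eqP; rewrite mulf_eq0 => /orP[]; apply/negP.
  by apply: natf_dvdn_neq0 f0; apply: bin_dvd_fact; lia.
by apply: natf_dvdn_neq0 f0; apply: dvdn_fact; lia.
Qed.

Lemma Fp_fact_neq0 p n : prime p -> (n < p)%N -> (n`!)%:R != 0 :> 'F_p.
Proof.
move=> pp; elim: n => [|n IH] ltnp; first by rewrite oner_neq0.
rewrite factS natrM mulf_neq0 ?IH ?(ltnW ltnp) //.
by rewrite -(dvdn_pcharf (pchar_Fp pp)) gtnNdvd.
Qed.

Lemma enum_covers n (A : {set 'Z_n}) (s : seq 'Z_n) :
  {in enum A &, forall x y, x != y -> x + y \in enum (restricted_sumset A) ++ s}.
Proof.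
move=> x y; rewrite !mem_enum mem_cat mem_enum => xA yA xy.
by apply/orP; left; apply/imset2P; exists x y; rewrite // inE yA.
Qed.

Lemma Fp_restricted_sumset_bound p (A : {set 'F_p}) n : prime p ->
  (#|A| <= n + 2)%N -> (n.+1 < p)%N -> (n + 3 < 2 * #|A|)%N ->
  (n < #|restricted_sumset A|)%N.
Proof.
move=> pp leAn ltnp ltA; rewrite ltnNge; apply/negP => leRn.
pose C := enum (restricted_sumset A) ++ nseq (n - #|restricted_sumset A|) 0.
have sC : size C = n by rewrite size_cat size_nseq -cardE subnKC.
have := @restricted_cover_bound 'F_p _ C (enum_uniq A) (@enum_covers _ A _).
by rewrite sC -cardE => /(_ leAn (Fp_fact_neq0 pp ltnp))/(leq_trans ltA); rewrite ltnn.
Qed.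

Lemma Fp_arc p (A : {set 'F_p}) : prime p -> (5 <= #|A|)%N ->
  (2 * #|A| - 3 < p)%N -> (#|restricted_sumset A| <= 2 * #|A| - 3)%N ->
  arc_up_to_affine A.
Proof.
move=> pp le5A ltAp leR; set k := #|A| in le5A ltAp leR.
pose C := enum (restricted_sumset A) ++
  nseq (2 * k - 3 - #|restricted_sumset A|) 0.
have critA : @critical 'F_p k (enum A).
  split; rewrite ?enum_uniq -?cardE //; exists C; last exact: enum_covers.
  by rewrite size_cat size_nseq -cardE subnKC.
(* As 2k - 2 is even and exceeds 2, it is not p. *)
have lt2kp : (2 * k - 2 < p)%N.
  have [|] := even_prime pp; first by lia.
  by have : odd (2 * k - 2) = false; lia.
have [d [t [d0 eqA]]] := critical_countField le5A (Fp_fact_neq0 pp lt2kp) critA.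
(* Dividing by the common difference gives an arc, which may start anywhere. *)
exists d^-1, 0; split; first by rewrite unitrV unitfE.
exists (d^-1 * t), k; apply/setP => x; apply/imsetP/imsetP.
  move=> [y]; rewrite -mem_enum eqA => /mapP[i + ->] ->; rewrite mem_iota => ltik.
  exists (Ordinal ltik) => //=.
  by rewrite mulrDr mulKf // addr0 addrC.
move=> [i _ ->]; exists (d * i%:R + t).
  by rewrite -mem_enum eqA; apply/mapP; exists (i : nat); rewrite ?mem_iota /=.
by rewrite mulrDr mulKf // addr0 addrC.
Qed.
(** 'F_p is 'Z_(pdiv p) by definition, so rewriting [pdiv p] to p transports the result. *)
Lemma restricted_sumset_bound p (A : {set 'Z_p}) n : prime p ->
  (#|A| <= n + 2)%N -> (n.+1 < p)%N -> (n + 3 < 2 * #|A|)%N ->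
  (n < #|restricted_sumset A|)%N.
Proof.
move=> pp; have := @Fp_restricted_sumset_bound p; rewrite pdiv_id //.
by move=> h; apply: h.
Qed.

Lemma critical_arc p (A : {set 'Z_p}) : prime p -> (5 <= #|A|)%N ->
  (2 * #|A| - 3 < p)%N -> (#|restricted_sumset A| <= 2 * #|A| - 3)%N ->
  arc_up_to_affine A.
Proof.
move=> pp; have := @Fp_arc p; rewrite pdiv_id //.
by move=> h; apply: h.
Qed.

(** * Colorings of 'Z_p *)

Lemma restricted_sumsetS n (A B : {set 'Z_n}) : A \subset B ->
  restricted_sumset A \subset restricted_sumset B.
Proof.
move=> /subsetP sAB; apply/subsetP => _ /imset2P[x y xA + ->].
rewrite inE => /andP[yA xy]; apply/imset2P; exists x y => //.
  exact: sAB.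
by rewrite inE sAB.
Qed.

Lemma subset_of_card (T : finType) (A : {set T}) n : (n <= #|A|)%N ->
  exists2 B : {set T}, B \subset A & #|B| = n.
Proof.
move=> leA; exists [set x in take n (enum A)].
  by apply/subsetP => x; rewrite inE => /mem_take; rewrite mem_enum.
rewrite cardsE; have /card_uniqP -> : uniq (take n (enum A)).
  by rewrite take_uniq ?enum_uniq.
by rewrite size_takel -?cardE.
Qed.

(** The coloring that attains the minimum; [inord] requires the number of colors to be a
    successor. *)
Definition block_coloring p k m : coloring p k.+1 :=
  [ffun x : 'Z_p => inord (x %/ m)].

Lemma block_coloring_value p k m : (1 < p)%N -> (p <= k.+1 * m)%N -> (2 <= m)%N ->
  (coloring_value (block_coloring p k m) <= 2 * m - 3)%N.
Proof.
move=> p1 lep m2; apply/bigmax_leqP => i _.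
(* Two distinct offsets below m add up to a number between 1 and 2m - 3. *)
suff sub : restricted_sumset (color_class (block_coloring p k m) i)
  \subset [set (2 * (i * m) + r.+1)%:R | r : 'I_(2 * m - 3)].
  by rewrite (leq_trans (subset_leq_card sub)) // (leq_trans (leq_imset_card _ _))
    // card_ord.
have block x : x \in color_class (block_coloring p k m) i ->
    exists2 r, (r < m)%N & nat_of_ord x = (i * m + r)%N.
  rewrite inE ffunE => /eqP <-; have ltx : (x < p)%N.
    by rewrite -[X in (_ < X)%N](Zp_cast p1).
  exists (x %% m)%N; first by rewrite ltn_mod; lia.
  rewrite inordK -?divn_eq // ltn_divLR; [exact: leq_trans lep|lia].
apply/subsetP => _ /imset2P[x y /block[r ltr xE] + ->].
rewrite inE => /andP[/block[s lts yE] xy].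
have neq : r != s by apply: contraNneq xy => rs; apply/eqP/val_inj; rewrite /= xE yE rs.
have ltrs : ((r + s).-1 < 2 * m - 3)%N by lia.
apply/imsetP; exists (Ordinal ltrs) => //=.
rewrite -[x]natr_Zp -[y]natr_Zp xE yE -natrD; congr (_%:R); lia.
Qed.
Unset Implicit Arguments.

Theorem theorem2 (p k m : nat)
    (hp : prime p) (hk2 : (2 <= k)%N) (hkp : (k <= p)%N)
    (hm : m%:Z = Num.ceil (p%:Q / k%:Q))
    (hmp : (2 * m - 3 < p)%N) (hm5 : (5 <= m)%N) :
  Phi_hat k p = (2 * m - 3)%N /\
  forall c : coloring p k, optimal c ->
    exists i : 'I_k,
      #|color_class c i| = m /\ arc_up_to_affine (color_class c i).
Proof.
have p1 := prime_gt1 hp.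
have [ltkm lepkm] : (k * m.-1 < p)%N /\ (p <= k * m)%N.
  have k0 : 0 < k%:Q by rewrite ltr0n; lia.
  have := ceil_itv (p%:Q / k%:Q); rewrite -hm.
  rewrite ltr_pdivlMr // ler_pdivrMr // => /andP[lo hi].
  move: lo hi; rewrite -!intrM ltr_int ler_int; lia.
(* Pigeonhole: k classes of at most m - 1 elements cannot cover p > k(m - 1) residues. *)
have large (c : coloring p k) : exists i, (m <= #|color_class c i|)%N.
  apply/existsP; apply: contraLR ltkm; rewrite negb_exists -leqNgt => /forallP small.
  have <- : #|'Z_p| = p by rewrite card_ord Zp_cast.
  rewrite -sum1_card (partition_big c xpredT) //=.
  rewrite -[k in (_ <= k * _)%N]card_ord -sum_nat_const leq_sum // => i _.
  have := small i; rewrite -ltnNge => lti; rewrite -ltnS prednK; last by lia.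
  apply: leq_ltn_trans lti; rewrite -sum1_card eq_leq //.
  by apply: eq_bigl => x; rewrite inE.
have value_ge (c : coloring p k) : (2 * m - 3 <= coloring_value c)%N.
  have [i /subset_of_card[B sB cB]] := large c.
  apply: leq_trans (leq_bigmax i).
  apply: leq_trans (subset_leq_card (restricted_sumsetS sB)).
  (* This is the largest n with n + 3 < 2m. *)
  have := @restricted_sumset_bound p B (2 * m - 4) hp.
  by rewrite cB; lia.
have PhiE : Phi_hat k p = (2 * m - 3)%N.
  apply/eqP; rewrite eqn_leq; apply/andP; split; last first.
    have [|c <-] := @Phi_hat_attained p k; [by lia | exact: value_ge].
  case: k hk2 lepkm {hkp hm ltkm large value_ge} => // k _ lep.
  apply: leq_trans (Phi_hat_le (block_coloring p k m)) _.
  by apply: block_coloring_value => //; lia.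
split=> // c optc; have [i lemA] := large c; exists i.
have leR : (#|restricted_sumset (color_class c i)| <= 2 * m - 3)%N.
  by rewrite -PhiE -optc; apply: (leq_bigmax i).
have cA : #|color_class c i| = m.
  apply/eqP; rewrite eqn_leq lemA andbT leqNgt; apply/negP.
  move=> /subset_of_card[B sB cB].
  (* With m + 1 elements there would be more than 2m - 3 sums; the bound at n = 2m - 3 asks for 2m -
     2 < p, and parity excludes equality. *)
  have p_odd : p != (2 * m - 2)%N.
    apply/negP => /eqP pE; have [|] := even_prime hp; first by lia.
    by rewrite pE; lia.
  have := @restricted_sumset_bound p B (2 * m - 3) hp.
  have := subset_leq_card (restricted_sumsetS sB).
  by rewrite cB; lia.
by split=> //; apply: critical_arc; rewrite ?cA.
Qed.
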